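(* Let $n\geq 2$ and set $c_n:=\sqrt{4^n-1}/\sqrt{3}$. For any nondegenerate convex domain $D\subset\mathbb{C}^n$, the squeezing functions $s_D$ and $\widehat{s}_D$ satisfy \[ s_D(z)\,\geq\,\frac{1}{\sqrt{n}\,(2c_n+1)}\quad\text{and}\quad \widehat{s}_D(z)\,\geq\,\frac{1}{2^{n+1}-1}\qquad\text{for all } z\in D. \]
   Context: $\mathbb{B}^n$ denotes the open Euclidean unit ball in $\mathbb{C}^n$ with centre $0$, $\mathbb{D}$ the open unit disc in $\mathbb{C}$ with centre $0$, and $\mathbb{D}^n$ the unit polydisc. A domain $D\subset\mathbb{C}^n$ is called nondegenerate if $D$ contains no complex lines (complex affine lines). For a domain $D\subset\mathbb{C}^n$ and $z\in D$, the squeezing function $s_D$ is \[ s_D(z):=\sup\{s_D(z;F) \mid F:D\to\mathbb{B}^n \text{ is an injective holomorphic map with } F(z)=0\}, \] where $s_D(z;F):=\sup\{r>0 : r\mathbb{B}^n\subset F(D)\}$; if there is no such map $F$, then $s_D(z):=0$. The function $\widehat{s}_D$ (the squeezing function based on $\mathbb{D}^n$) is defined in the same way with $\mathbb{D}^n$ replacing $\mathbb{B}^n$ throughout, i.e. $\widehat{s}_D(z)$ is the supremum, over injective holomorphic maps $F:D\to\mathbb{D}^n$ with $F(z)=0$, of $\sup\{r>0 : r\mathbb{D}^n\subset F(D)\}$ (and it is $0$ if there is no such $F$). *)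

(* Defs.v *)
From HB Require Import structures.
From mathcomp Require Import all_boot all_order all_algebra.
From mathcomp Require Import complex.
From mathcomp Require Import all_classical all_reals.
From mathcomp Require Import topology normedtype landau derive convex.

Set Implicit Arguments.
Unset Strict Implicit.
Unset Printing Implicit Defensive.

Import Order.TTheory GRing.Theory Num.Theory.
Import numFieldNormedType.Exports.

Local Open Scope classical_set_scope.
Local Open Scope ring_scope.

(* The complex numbers over R, presented as an abstract numClosedFieldType so
   that Cplx R and 'rV[Cplx R]_n inherit the Cplx R-linear topological and
   normed structures of MathComp-Analysis; on R[i] itself the canonical lmodType
   structure is the one over R. *)
Definition Cplx (R : realType) : numClosedFieldType := R[i].

Definition to_cplx (R : realType) (r : R) : Cplx R := real_complex R r.

Section squeezing.
Context {R : realType} {n : nat}.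
Implicit Types (D Omega : set 'rV[Cplx R]_n)
  (F : 'rV[Cplx R]_n -> 'rV[Cplx R]_n).

Definition is_domain D : Prop := [/\ open D, D !=set0 & connected D].

(* convex_set takes its coefficients t in Cplx R with 0 <= t <= 1; in the order
   of Cplx R this forces t to be real, so this is convexity over the reals. *)
Definition is_convex D : Prop := @convex_set (Cplx R) 'rV[Cplx R]_n D.

Definition complex_line (a v : 'rV[Cplx R]_n) : set 'rV[Cplx R]_n :=
  [set a + t *: v | t in [set: Cplx R]].

Definition nondegenerate_domain D : Prop :=
  forall a v : 'rV[Cplx R]_n, v != 0 -> ~ (complex_line a v `<=` D).

Definition unit_ball : set 'rV[Cplx R]_n :=
  [set z | \sum_(j < n) `|z ord0 j| ^+ 2 < 1].

Definition unit_polydisc : set 'rV[Cplx R]_n :=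
  [set z | forall j, `|z ord0 j| < 1].

(* Fréchet differentiability over Cplx R; the values of F outside the open set D
   are irrelevant. *)
Definition holomorphic_on D F : Prop := forall z, D z -> differentiable F z.

Definition dilate (r : R) Omega : set 'rV[Cplx R]_n :=
  [set to_cplx r *: w | w in Omega].

Definition squeezing_map Omega D (z : 'rV[Cplx R]_n) F : Prop :=
  [/\ holomorphic_on D F, set_inj D F, F @` D `<=` Omega & F z = 0].

Definition squeezing_radius Omega D F : R :=
  sup [set r : R | 0 < r /\ dilate r Omega `<=` F @` D].

(* Squeezing function of D with model Omega. When no F qualifies the value is 0
   because sup set0 = 0. For Omega the unit ball or polydisc and 0 < n every
   radius involved is at most 1, so both suprema are of bounded sets. *)
Definition squeezing Omega D (z : 'rV[Cplx R]_n) : R :=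
  sup [set squeezing_radius Omega D F | F in squeezing_map Omega D z].

End squeezing.

Definition s_ball {R : realType} {n : nat} (D : set 'rV[Cplx R]_n) :=
  squeezing unit_ball D.

Definition s_polydisc {R : realType} {n : nat} (D : set 'rV[Cplx R]_n) :=
  squeezing unit_polydisc D.

Definition c_const (R : realType) (n : nat) : R :=
  Num.sqrt (4 ^+ n - 1) / Num.sqrt 3.

(* Main.v *)
(* Translate z to the origin.  Inductively choose q_k in the common kernel of
   the functionals found so far such that {t q_k : |t| < 1} is a maximal disc
   in D on the line C q_k, so that q_k is not in D; a supporting real
   hyperplane at q_k gives a complex functional l_k with Re l_k < 1 on D and
   l_k(q_k) = 1.  The matrix (l_j(q_k)) is unitriangular and the discs force
   its entries to have modulus at most 1.  Hence the coordinates u of x in the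
   basis q satisfy sum_k |u_k| <= sum_j 2^j |l_j(x)|, and x lies in D as soon
   as the right-hand side is less than 1.  On the other hand l / (2 - l) maps
   the half-plane Re l < 1 onto the unit disc, so applying it to each l_j maps
   D into the polydisc (and 1/sqrt n times it, into the ball) with an image
   containing the required polydisc, respectively, by Cauchy-Schwarz, ball:
   c_n^2 is the sum of the 4^j. *)
From HB Require Import structures.
Require Import Defs.
From mathcomp Require Import all_boot all_order all_algebra.
From mathcomp Require Import complex interval_inference.
From mathcomp Require Import all_classical all_reals.
From mathcomp Require Import topology normedtype landau derive convex.
From mathcomp Require Import ring lra.

Set Implicit Arguments.
Unset Strict Implicit.
Unset Printing Implicit Defensive.

Import Order.TTheory GRing.Theory Num.Theory.
Import numFieldNormedType.Exports.

Local Open Scope classical_set_scope.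
Local Open Scope ring_scope.

(** * Sublinear functions and the Hahn-Banach theorem in finite dimension *)

Definition sublinear {R : realType} {V : lmodType R} (p : V -> R) : Prop :=
  (forall x y, p (x + y) <= p x + p y) /\
  (forall a x, 0 < a -> p (a *: x) <= a * p x).

Lemma sublinear0 {R : realType} {V : lmodType R} (p : V -> R) :
  sublinear p -> p 0 = 0.
Proof.
move=> [pD pZ]; have := pD 0 0; rewrite addr0 => h1.
(* [h1] gives [0 <= p 0]; the factor 1/2 gives [p 0 <= p 0 / 2], hence [p 0 <= 0]. *)
have := pZ 2^-1 0; rewrite scaler0 invr_gt0 ltr0n => /(_ isT) h2; lra.
Qed.

Lemma sublinearN {R : realType} {V : lmodType R} (p : V -> R) x :
  sublinear p -> - p (- x) <= p x.
Proof.
move=> ps; have := ps.1 x (- x); rewrite subrr (sublinear0 ps); lra.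
Qed.

(** Subhomogeneity for the factor [a^-1], applied at [a *: x], supplies the reverse inequality. *)
Lemma sublinearZ {R : realType} {V : lmodType R} (p : V -> R) a x :
  sublinear p -> 0 <= a -> p (a *: x) = a * p x.
Proof.
move=> ps; rewrite le_eqVlt => /orP[/eqP <-|a0].
  by rewrite scale0r mul0r sublinear0.
apply/eqP; rewrite eq_le ps.2 //=.
have := ps.2 a^-1 (a *: x); rewrite invr_gt0 scalerA mulVf ?gt_eqF// scale1r.
by move=> /(_ a0); rewrite -ler_pdivlMl.
Qed.

(* The function x |-> inf_(t >= 0) p (x + t v) - t p v. *)
Lemma sublinear_flatten {R : realType} {V : lmodType R} (p : V -> R) (v : V) :
  sublinear p ->
  exists p', [/\ sublinear p', forall x, p' x <= p x & p' (- v) <= - p v].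
Proof.
move=> ps; pose E x := [set p (x + t *: v) - t * p v | t in [set t | 0 <= t]].
have E0 x : E x !=set0 by exists (p (x + 0 *: v) - 0 * p v), 0 => //=.
(* Here [t * p v = p (t *: v) <= p (x + t *: v) + p (- x)]. This bound makes the infimum genuine
   rather than a default value. *)
have Elb x : lbound (E x) (- p (- x)).
  move=> _ [t /= t0 <-]; rewrite -(sublinearZ _ ps t0).
  have := ps.1 (x + t *: v) (- x); rewrite addrAC subrr add0r; lra.
have Ehlb x : has_lbound (E x) by exists (- p (- x)); exact: Elb.
have infE x t : 0 <= t -> inf (E x) <= p (x + t *: v) - t * p v.
  by move=> t0; apply: ge_inf => //; exists t.
exists (fun x => inf (E x)); split.
- split=> [x y|a x a0].
    rewrite -lerBlDl; apply: lb_le_inf => // _ [t /= t0 <-].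
    rewrite lerBlDr -lerBlDl; apply: lb_le_inf => // _ [s /= s0 <-].
    rewrite lerBlDl; apply: le_trans (infE (x + y) (s + t) _) _.
      exact: addr_ge0.
    rewrite scalerDl addrACA.
    have := ps.1 (x + s *: v) (y + t *: v); lra.
  rewrite -ler_pdivrMl//; apply: lb_le_inf => // _ [t /= t0 <-].
  rewrite ler_pdivrMl//; apply: le_trans (infE (a *: x) (a * t) _) _.
    by rewrite mulr_ge0// ltW.
  by rewrite -scalerA -scalerDr (sublinearZ _ ps (ltW a0)) mulrBr mulrA.
- by move=> x; have := infE x 0 (lexx _); rewrite scale0r addr0 mul0r subr0.
- have := infE (- v) 1 ler01.
  by rewrite scale1r addNr sublinear0// mul1r sub0r.
Qed.

(** Flattening is iterated over the vectors of [s]. Oddness gained at [w] survives later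
    flattenings, because a smaller function can only lower [p (- w)] and raise [- p w]. *)
Lemma sublinear_flatten_seq {R : realType} {V : lmodType R} (p : V -> R)
    (s : seq V) :
  sublinear p ->
  exists p', [/\ sublinear p', forall x, p' x <= p x &
                 forall v, v \in s -> p' (- v) <= - p' v].
Proof.
elim: s => [|v s IHs] ps; first by exists p; split.
have [p1 [p1s p1p p1N]] := IHs ps.
have [p2 [p2s p2p1 p2N]] := sublinear_flatten v p1s.
exists p2; split=> // [x|w]; first exact: le_trans (p2p1 x) (p1p x).
rewrite in_cons => /orP[/eqP ->|ws].
  by apply: le_trans p2N _; rewrite lerN2.
by have := p1N _ ws; have := p2p1 w; have := p2p1 (- w); lra.
Qed.

(* The vectors on which a sublinear function is odd form a subspace, on which
   it is linear. *)
Lemma sublinear_odd_lin {R : realType} {V : lmodType R} (p : V -> R) a x y :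
  sublinear p -> p (- x) <= - p x -> p (- y) <= - p y ->
  p (a *: x + y) = a * p x + p y /\ p (- (a *: x + y)) <= - p (a *: x + y).
Proof.
move=> ps xN yN.
have xNE : p (- x) = - p x by have := sublinearN x ps; lra.
have ZE b : p (b *: x) = b * p x.
  have [b0|b0] := leP 0 b; first exact: sublinearZ.
  rewrite -[b]opprK scaleNr -scalerN sublinearZ ?oppr_ge0 ?ltW// xNE; lra.
have h1 := ps.1 (a *: x) y; rewrite ZE in h1.
have h2 := ps.1 (- a *: x) (- y); rewrite ZE scaleNr -opprD in h2.
have h3 := sublinearN (a *: x + y) ps.
by split; lra.
Qed.

(** Flattening at [q] first fixes the value to be reached there; flattening at the standard basis
    then yields a minorant that is odd on a basis, hence linear. *)
Lemma hahn_banach_row {R : realType} {m : nat} (p : 'rV[R]_m -> R) q :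
  sublinear p ->
  exists c : 'cV[R]_m, (forall x, (x *m c) ord0 ord0 <= p x) /\
    p q <= (q *m c) ord0 ord0.
Proof.
move=> ps; have [p1 [p1s p1p p1N]] := sublinear_flatten q ps.
have [p2 [p2s p2p1 p2N]] :=
  sublinear_flatten_seq [seq delta_mx ord0 i | i <- enum 'I_m] p1s.
pose c : 'cV[R]_m := \col_i p2 (delta_mx ord0 i).
have cE x : p2 x = (x *m c) ord0 ord0.
  rewrite mxE {1}(row_sum_delta x).
  under [RHS]eq_bigr do rewrite mxE.
  (* Oddness is carried through the induction together with the value, since additivity is obtained
     from oddness of both summands. *)
  have : p2 (- \sum_j x ord0 j *: delta_mx ord0 j) <=
           - p2 (\sum_j x ord0 j *: delta_mx ord0 j) /\
         p2 (\sum_j x ord0 j *: delta_mx ord0 j) =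
           \sum_j x ord0 j * p2 (delta_mx ord0 j).
    elim/big_ind2 : _ => [|y r z s [yN <-] [zN <-]|i _].
    - by rewrite oppr0 sublinear0// oppr0.
    - by have [] := sublinear_odd_lin 1 p2s yN zN; rewrite scale1r mul1r.
    have eN : p2 (- delta_mx ord0 i) <= - p2 (delta_mx ord0 i).
      by apply: p2N; rewrite map_f// mem_enum.
    have zN : p2 (- 0) <= - p2 0 by rewrite oppr0 sublinear0// oppr0.
    have [] := sublinear_odd_lin (x ord0 i) p2s eN zN.
    by rewrite !addr0 sublinear0// addr0 => -> ?.
  by case.
exists c; split=> [x|].
  by rewrite -cE; exact: le_trans (p2p1 x) (p1p x).
have : (- q *m c) ord0 ord0 <= - p q by rewrite -cE (le_trans (p2p1 _)).
by rewrite mulNmx mxE; lra.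
Qed.

(** * Real and imaginary parts, and the order on the complex scalars *)

HB.instance Definition _ (R : realType) :=
  GRing.RMorphism.copy (@to_cplx R) (real_complex R).

Definition re {R : realType} (z : Cplx R) : R := complex.Re z.
Definition im {R : realType} (z : Cplx R) : R := complex.Im z.

Arguments re : simpl never.
Arguments im : simpl never.

Section scalars.
Context {R : realType}.
Implicit Types (r : R) (z w : Cplx R).

Lemma cplxE z : z = to_cplx (re z) + 'i * to_cplx (im z).
Proof. by rewrite {1}[z]complexE complexiE. Qed.

Lemma reD z w : re (z + w) = re z + re w.
Proof. by case: z w => [a b] [c d]. Qed.

Lemma re_to_cplx r : re (to_cplx r) = r. Proof. by []. Qed.
Lemma im_to_cplx r : im (to_cplx r) = 0. Proof. by []. Qed.

Lemma re_sum (I : finType) (F : I -> Cplx R) :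
  re (\sum_i F i) = \sum_i re (F i).
Proof. by apply: big_morph; first exact: reD. Qed.

Lemma ler_cplx r s : (to_cplx r <= to_cplx s) = (r <= s).
Proof. exact: lecR. Qed.

Lemma ltr_cplx r s : (to_cplx r < to_cplx s) = (r < s).
Proof. exact: ltcR. Qed.

Lemma norm_cplx z : `|z| = to_cplx (Num.sqrt (re z ^+ 2 + im z ^+ 2)).
Proof. exact: normc_def. Qed.

Lemma norm_re z : `|z| = to_cplx (re `|z|).
Proof. by rewrite norm_cplx. Qed.

Lemma norm_to_cplx r : `|to_cplx r| = to_cplx `|r|.
Proof. by rewrite norm_cplx im_to_cplx re_to_cplx expr0n addr0 sqrtr_sqr. Qed.

(** Normalises l_k(q_k): the supporting hyperplane bounds its real part from below and the maximal
    disc bounds its modulus from above. *)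
Lemma cplx_eq1 z : 1 <= re z -> `|z| <= 1 -> z = 1.
Proof.
move=> z1; rewrite norm_cplx -[1]/(to_cplx 1) ler_cplx => n1.
have n2 : re z ^+ 2 + im z ^+ 2 <= 1.
  by rewrite -[leLHS]sqr_sqrtr ?addr_ge0 ?sqr_ge0// expr_le1 ?sqrtr_ge0.
have i0 : im z = 0.
  by apply/eqP; rewrite -sqrf_eq0; have := sqr_ge0 (im z); nra.
have r1 : re z = 1 by have := sqr_ge0 (im z); nra.
by rewrite [z]cplxE i0 r1 rmorph0 mulr0 addr0 rmorph1.
Qed.
End scalars.

Lemma convex_mix {R : realType} {n : nat} (D : set 'rV[Cplx R]_n) x y
    (a b : R) :
  is_convex D -> D x -> D y -> 0 <= a -> 0 <= b -> a + b = 1 ->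
  D (to_cplx a *: x + to_cplx b *: y).
Proof.
move=> Dc Dx Dy a0 b0 ab.
have a1 : to_cplx a <= 1 by rewrite -[1]/(to_cplx 1) ler_cplx; lra.
have a0' : 0 <= to_cplx a by rewrite -[0]/(to_cplx 0) ler_cplx.
have := Dc x y (Itv01 a0' a1).
rewrite !inE => /(_ Dx Dy).
have -> // : to_cplx b = 1 - to_cplx a.
by rewrite -[1]/(to_cplx 1) -rmorphB; congr to_cplx; lra.
Qed.

Lemma open_disc {R : realType} {n : nat} (D : set 'rV[Cplx R]_n) x v :
  open D -> D x ->
  exists e : R, 0 < e /\ forall c : Cplx R, `|c| < to_cplx e -> D (x + c *: v).
Proof.
move=> Do Dx.
have : nbhs (0 : Cplx R) [set c | D (x + c *: v)].
  have cf : {for (0 : Cplx R), continuous (fun c : Cplx R => x + c *: v)}.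
    apply: (@cvgD _ _ _ (nbhs (0 : Cplx R)) (nbhs_filter _)
             (cst x) (fun c : Cplx R => c *: v) x (0 *: v)).
      exact: (@cvg_cst _ x _ _ (nbhs_filter _)).
    by apply: (@cvgZr_tmp _ _ _ _ (nbhs_filter (0 : Cplx R)) id).
  by apply: cf; apply: open_nbhs_nbhs; rewrite scale0r addr0; split.
move=> [e /= e0 eD]; exists (re e).
(* The radius provided by the topology is an element of [Cplx R]; being positive, it is real. *)
have eE : to_cplx (re e) = e by apply: RRe_real; exact: gtr0_real.
split; first by rewrite -ltr_cplx eE.
by move=> c; rewrite eE => ce; apply: eD; rewrite /= sub0r normrN.
Qed.

(** * The gauge of an open convex set containing the origin *)

Section gauge.
Context {R : realType} {n : nat}.
Variable D : set 'rV[Cplx R]_n.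
Hypotheses (D_open : open D) (D_convex : is_convex D) (D0 : D 0).
Implicit Types (x y q : 'rV[Cplx R]_n) (t : R).

(** The Minkowski functional. Only real dilations occur: [D] need not be circled, so homogeneity is
    expected for positive real factors only. *)
Definition gauge x : R := inf [set t | 0 < t /\ D (to_cplx t^-1 *: x)].

Lemma gauge_lb x : lbound [set t | 0 < t /\ D (to_cplx t^-1 *: x)] 0.
Proof. by move=> t [/ltW]. Qed.

Lemma gauge_nonempty x : [set t | 0 < t /\ D (to_cplx t^-1 *: x)] !=set0.
Proof.
have [e [e0 eD]] := open_disc x D_open D0.
exists (2 / e); split; first by rewrite divr_gt0.
rewrite -[_ *: x]add0r; apply: eD; rewrite norm_to_cplx ltr_cplx.
by rewrite invf_div ger0_norm ?divr_ge0 ?ltW// ltr_pdivrMr// ltr_pMr// ltr1n.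
Qed.

Lemma gauge_ge0 x : 0 <= gauge x.
Proof. exact: lb_le_inf (gauge_nonempty x) (@gauge_lb x). Qed.

Lemma gauge_le x t : 0 < t -> D (to_cplx t^-1 *: x) -> gauge x <= t.
Proof. by move=> t0 Dt; apply: ge_inf => //; exists 0; exact: gauge_lb. Qed.

Lemma gauge_lt x t : gauge x < t -> D (to_cplx t^-1 *: x).
Proof.
move=> gt; have [s [s0 Ds] st] := inf_lt (gauge_nonempty x) gt.
have t0 : 0 < t by exact: lt_trans st.
have h0 : 0 <= s / t by rewrite divr_ge0// ltW.
have h1 : 0 <= 1 - s / t by rewrite subr_ge0 ler_pdivrMr// mul1r ltW.
have := convex_mix D_convex Ds D0 h0 h1 (subrKC _ _).
by rewrite scaler0 addr0 scalerA -rmorphM mulrAC divff ?gt_eqF// mul1r.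
Qed.

Lemma gauge_lt1 x : D x <-> gauge x < 1.
Proof.
split=> [Dx|/gauge_lt]; last by rewrite invr1 rmorph1 scale1r.
(* Openness leaves room to enlarge [x] by the factor [1 + e / 2] inside [D], which makes the
   inequality strict. *)
have [e [e0 eD]] := open_disc x D_open Dx.
have d0 : 0 < 1 + e / 2 by rewrite addr_gt0// divr_gt0.
have : gauge x <= (1 + e / 2)^-1.
  apply: gauge_le; first by rewrite invr_gt0.
  rewrite invrK rmorphD rmorph1 scalerDl scale1r; apply: eD.
  rewrite norm_to_cplx ltr_cplx ger0_norm ?divr_ge0 ?ltW//; lra.
move/le_lt_trans; apply; rewrite invf_lt1//; lra.
Qed.

Lemma gaugeD x y : gauge (x + y) <= gauge x + gauge y.
Proof.
apply/ler_addgt0Pr => e e0; set s := gauge x + e / 2; set t := gauge y + e / 2.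
have s0 : 0 < s by have := gauge_ge0 x; rewrite /s; lra.
have t0 : 0 < t by have := gauge_ge0 y; rewrite /t; lra.
rewrite (_ : _ + e = s + t); last by rewrite /s /t; lra.
apply: gauge_le; first exact: addr_gt0.
have Ds : D (to_cplx s^-1 *: x) by apply: gauge_lt; rewrite /s; lra.
have Dt : D (to_cplx t^-1 *: y) by apply: gauge_lt; rewrite /t; lra.
have st0 : s + t != 0 by rewrite gt_eqF// addr_gt0.
(* [(x + y) / (s + t)] is the convex combination of [x / s] and [y / t] with weights [s / (s + t)]
   and [t / (s + t)]. *)
have hs : 0 <= s / (s + t) by apply: divr_ge0; [|apply: addr_ge0]; apply: ltW.
have ht : 0 <= t / (s + t) by apply: divr_ge0; [|apply: addr_ge0]; apply: ltW.
have hst : s / (s + t) + t / (s + t) = 1 by rewrite -mulrDl divff.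
have := convex_mix D_convex Ds Dt hs ht hst.
rewrite !scalerA -!rmorphM.
rewrite (mulrAC s) (mulrAC t) !divff ?gt_eqF// !mul1r.
by rewrite -scalerDr.
Qed.

Lemma gaugeZ a x : 0 < a -> gauge (to_cplx a *: x) <= a * gauge x.
Proof.
move=> a0; apply/ler_addgt0Pr => e e0; set t := gauge x + e / a.
have ea : 0 < e / a by exact: divr_gt0.
have t0 : 0 < t by have := gauge_ge0 x; rewrite /t; lra.
have -> : a * gauge x + e = a * t by rewrite mulrDr mulrCA divff ?mulr1 ?gt_eqF.
apply: gauge_le; first exact: mulr_gt0.
rewrite scalerA -rmorphM invfM mulrAC mulVf ?gt_eqF// mul1r.
by apply: gauge_lt; rewrite /t; lra.
Qed.

Lemma gauge_sum (I : finType) (x : I -> 'rV[Cplx R]_n) :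
  gauge (\sum_i x i) <= \sum_i gauge (x i).
Proof.
elim/big_ind2 : _ => // [|y s z t ys zt].
  apply/ler_addgt0Pr => e e0; rewrite add0r.
  by apply: gauge_le; rewrite // scaler0.
exact: le_trans (gaugeD _ _) (lerD ys zt).
Qed.

(** For complex factors, a control by the modulus comes from a whole disc inside [D]. *)
Lemma gauge_disc q c :
  (forall b : Cplx R, `|b| < 1 -> D (b *: q)) -> gauge (c *: q) <= re `|c|.
Proof.
move=> qD; have c0 : 0 <= re `|c| by rewrite -ler_cplx -norm_re rmorph0.
apply/ler_addgt0Pr => e e0.
have ce : 0 < re `|c| + e by lra.
apply: gauge_le => //; rewrite scalerA; apply: qD.
rewrite normrM norm_to_cplx (norm_re c) -rmorphM -(rmorph1 (@to_cplx R)).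
rewrite ltr_cplx gtr0_norm ?invr_gt0// mulrC ltr_pdivrMr//; lra.
Qed.

End gauge.

(** * Supporting complex functionals *)

Lemma re_mul_conj {R : realType} (z : Cplx R) (a b : R) :
  re (z * (to_cplx a - 'i * to_cplx b)) = re z * a + im z * b.
Proof. by case: z => x y; rewrite -complexiE /re /im /=; ring. Qed.

Definition of_real_row {R : realType} {n : nat} (u : 'rV[R]_(n + n)) :
    'rV[Cplx R]_n :=
  map_mx (@to_cplx R) (lsubmx u) + 'i *: map_mx (@to_cplx R) (rsubmx u).

Definition to_real_row {R : realType} {n : nat} (z : 'rV[Cplx R]_n) :
    'rV[R]_(n + n) :=
  row_mx (map_mx (@re R) z) (map_mx (@im R) z).

Lemma to_real_rowK {R : realType} {n : nat} :
  cancel (@to_real_row R n) of_real_row.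
Proof.
move=> z; rewrite /of_real_row row_mxKl row_mxKr.
by apply/rowP => j; rewrite !mxE [RHS]cplxE.
Qed.

Lemma supporting_functional {R : realType} {n : nat} (D : set 'rV[Cplx R]_n) q :
  open D -> is_convex D -> D 0 -> ~ D q ->
  exists w : 'cV[Cplx R]_n,
    (forall z, D z -> re ((z *m w) ord0 ord0) < 1) /\
    1 <= re ((q *m w) ord0 ord0).
Proof.
move=> Do Dc D0 Dq.
have ps : sublinear (fun u => gauge D (of_real_row u)).
  split=> [u v|a u a0].
    rewrite /of_real_row [lsubmx _]linearD [rsubmx _]linearD !map_mxD/=.
    by rewrite scalerDr addrACA gaugeD.
  rewrite [X in gauge D X](_ : _ = to_cplx a *: of_real_row u) ?gaugeZ//.
  by apply/rowP => j; rewrite !mxE !rmorphM mulrDr mulrCA.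
have [c [cp cq]] := hahn_banach_row (to_real_row q) ps.
(* Since Re((x + iy)(a - ib)) = xa + yb, the real functional with coefficients (a, b) is the real
   part of the complex functional a - ib. *)
pose w : 'cV[Cplx R]_n :=
  map_mx (@to_cplx R) (usubmx c) - 'i *: map_mx (@to_cplx R) (dsubmx c).
have wE z : re ((z *m w) ord0 ord0) = (to_real_row z *m c) ord0 ord0.
  rewrite -[c in RHS]vsubmxK mul_row_col !mxE re_sum -big_split/=.
  by apply: eq_bigr => j _; rewrite !mxE re_mul_conj.
exists w; split=> [z Dz|]; rewrite wE.
  apply: le_lt_trans (cp _) _; rewrite to_real_rowK.
  exact/gauge_lt1.
apply: le_trans cq; rewrite to_real_rowK leNgt; apply/negP.
by move=> /(gauge_lt1 Do Dc D0).
Qed.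

Lemma re_cplx {R : realType} (a b : R) : re (to_cplx a + 'i * to_cplx b) = a.
Proof. by rewrite -complexiE /re /=; ring. Qed.

Lemma im_cplx {R : realType} (a b : R) : im (to_cplx a + 'i * to_cplx b) = b.
Proof. by rewrite -complexiE /im /=; ring. Qed.

(** * Maximal discs on complex lines through the origin *)

Lemma maximal_disc {R : realType} {n : nat} (D : set 'rV[Cplx R]_n) v :
  open D -> D 0 -> ~ complex_line 0 v `<=` D ->
  exists c : Cplx R, ~ D (c *: v) /\
    forall b : Cplx R, `|b| < 1 -> D (b *: (c *: v)).
Proof.
move=> Do D0 /existsNP[_] /not_implyP[[c0 _ <-]]; rewrite add0r => Dc0.
pose cp (p : R * R) : Cplx R := to_cplx p.1 + 'i * to_cplx p.2.
pose nrm2 (p : R * R) : R := p.1 ^+ 2 + p.2 ^+ 2.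
have nrm2_ge0 p : 0 <= nrm2 p by rewrite addr_ge0 ?sqr_ge0.
have cpN p : `|cp p| = to_cplx (Num.sqrt (nrm2 p)).
  by rewrite norm_cplx re_cplx im_cplx.
have cpE c : cp (re c, im c) = c by rewrite [RHS]cplxE.
pose M := Num.sqrt (nrm2 (re c0, im c0)).
have M0 : 0 <= M by exact: sqrtr_ge0.
pose B : set (R * R) := `[- M, M]%classic `*` `[- M, M]%classic.
have cB : compact B by apply: compact_setX; exact: segment_compact.
have BM p : nrm2 p <= nrm2 (re c0, im c0) -> B p.
  move=> pM; split; rewrite /= in_itv/= -ler_norml -sqrtr_sqr ler_wsqrtr//.
    by apply: le_trans pM; rewrite lerDl sqr_ge0.
  by apply: le_trans pM; rewrite lerDr sqr_ge0.
(* Parameters in a compact box of points of the line outside [D]. A member of [K] nearest to 0 is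
   the required [c]; [c0] shows that there is one. *)
pose K := B `&` ~` [set p | D (cp p *: v)].
have cK : compact K.
  apply: compact_closedI => //; rewrite closedC openE => -[x y] /= Dxy.
  have [e [e0 eD]] := open_disc v Do Dxy.
  have e2 : 0 < e / 2 by rewrite divr_gt0.
  exists (ball x (e / 2), ball y (e / 2)) => /=.
    by split; exact: nbhsx_ballx.
  move=> [x' y'] /= [xx yy].
  have -> : cp (x', y') *: v = cp (x, y) *: v + cp (x' - x, y' - y) *: v.
    rewrite -scalerDl; congr (_ *: _).
    by rewrite /cp/= !rmorphB/=; ring.
  apply: eD; rewrite /cp/=.
  apply: le_lt_trans (ler_normD _ _) _.
  rewrite normrM normCi mul1r !norm_to_cplx -rmorphD ltr_cplx.
  move: xx yy; rewrite /ball /= (distrC x) (distrC y); lra.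
have K0 : K (re c0, im c0) by split; [exact: BM|rewrite /= cpE].
have nrm2c : {within K, continuous nrm2}.
  apply: continuous_subspaceT => p.
  by apply: cvgD; apply: cvgM; solve [exact: cvg_fst|exact: cvg_snd].
have [p /set_mem[Bp Dp] pmin] := compact_EVT_min (ex_intro _ _ K0) cK nrm2c.
exists (cp p); split=> // b b1; apply: contrapT; rewrite scalerA => Db.
have p0 : nrm2 p != 0.
  apply/eqP => p0; apply: Dp => /=; suff -> : cp p = 0 by rewrite scale0r.
  by apply/eqP; rewrite -normr_eq0 cpN p0 sqrtr0 rmorph0.
have p1 : 0 < nrm2 p by rewrite lt_def p0 nrm2_ge0.
(* [b * cp p] is strictly nearer to 0, so it stays in the box and, by [Db], belongs to [K], against
   minimality. *)
have lt : nrm2 (re (b * cp p), im (b * cp p)) < nrm2 p.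
  rewrite -(ltr_sqrt _ p1) -ltr_cplx -cpN cpE normrM cpN -[ltRHS]mul1r.
  rewrite ltr_pM2r//.
  by rewrite -(rmorph0 (@to_cplx R)) ltr_cplx sqrtr_gt0.
have : nrm2 p <= nrm2 (re (b * cp p), im (b * cp p)).
  apply: (pmin); apply/mem_set; split; last by rewrite /= cpE.
  by apply: BM; apply: le_trans (ltW lt) _; apply: pmin; exact/mem_set.
by rewrite leNgt lt.
Qed.

(** * Triangular systems of points and functionals *)

Lemma re_disc_le1 {R : realType} (a : Cplx R) :
  (forall b : Cplx R, `|b| < 1 -> re (b * a) < 1) -> `|a| <= 1.
Proof.
move=> ab; have [//|a1] := real_leP (normr_real a) (@real1 _).
have a0 : a != 0 by rewrite -normr_gt0 (lt_trans ltr01).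
(* If [a] had modulus above 1, then [b = a^-1] would be admissible, with [b * a = 1] of real part
   1. *)
have := ab a^-1; rewrite mulVf// normfV invf_lt1 ?normr_gt0// => /(_ a1).
by rewrite ltxx.
Qed.

(** Let S be the sum of all terms but the first. Then the first is at most b_0 + S, so the total is
    at most b_0 + 2S; this doubling at each index produces the powers of 2. *)
Lemma triangular_sum_le {K : numDomainType} {n : nat} (a b : 'I_n -> K) :
  (forall j, a j <= b j + \sum_(k < n | (j < k)%N) a k) ->
  \sum_j a j <= \sum_(j < n) 2 ^+ j * b j.
Proof.
elim: n a b => [|n IHn] a b ab; first by rewrite !big_ord0.
have {}IHn : \sum_(j < n) a (lift ord0 j) <=
    \sum_(j < n) 2 ^+ j * b (lift ord0 j).
  apply: (IHn (fun j => a (lift ord0 j)) (fun j => b (lift ord0 j))) => j.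
  have := ab (lift ord0 j).
  by rewrite big_mkcond big_ord_recl/= add0r -big_mkcond.
have := ab ord0; rewrite big_mkcond big_ord_recl/= add0r => a0.
rewrite !big_ord_recl expr0 mul1r.
apply: le_trans (lerD a0 (lexx _)) _; rewrite -addrA lerD2l.
apply: le_trans (lerD IHn IHn) _; rewrite -big_split/=.
by apply: ler_sum => j _; rewrite /bump/= exprS -mulrA mulr_natl mulr2n.
Qed.

(** While [k < n], the kernel of [W] is nonzero and supplies the line for the next disc. The new
    pair is placed at index 0: as [q *m W = 0], the first row of the new product is (1, 0) and the
    product stays lower triangular. *)
Lemma adapted_system {R : realType} {n : nat} (D : set 'rV[Cplx R]_n) k :
  open D -> is_convex D -> nondegenerate_domain D -> D 0 -> (k <= n)%N ->
  exists (Q : 'M[Cplx R]_(k, n)) (W : 'M[Cplx R]_(n, k)),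
    [/\ is_trig_mx (Q *m W), forall i, (Q *m W) i i = 1,
        forall z j, D z -> re ((z *m W) ord0 j) < 1 &
        forall i (c : Cplx R), `|c| < 1 -> D (c *: row i Q)].
Proof.
move=> Do Dc Dn D0; elim: k => [_|k IHk kn].
  by exists 0, 0; split=> [|[]//|z []//|[]//]; apply/is_trig_mxP => -[].
have [Q [W [QWt QW1 WD QD]]] := IHk (ltnW kn).
pose v := nz_row (kermx W).
have v0 : v != 0.
  rewrite nz_row_eq0 -mxrank_eq0 mxrank_ker subn_eq0 -ltnNge.
  exact: leq_ltn_trans (rank_leq_col W) kn.
have vW : v *m W = 0 by apply/sub_kermxP; exact: nz_row_sub.
have [c [Dcv cvD]] := maximal_disc Do D0 (Dn 0 v v0).
have [w [wD wq]] := supporting_functional Do Dc D0 Dcv.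
set q := c *: v in Dcv cvD wq.
have qW : q *m W = 0 by rewrite -scalemxAl vW scaler0.
have qw : q *m w = 1%:M.
  rewrite [LHS]mx11_scalar; congr (_%:M); apply: cplx_eq1 => //.
  apply: re_disc_le1 => b /cvD/wD; by rewrite -scalemxAl mxE.
rewrite -[k.+1]/(1 + k)%N; exists (col_mx q Q), (row_mx w W).
rewrite mul_col_row qw qW; split.
- by rewrite is_trig_block_mx// eqxx QWt scalar_mx_is_trig.
- move=> i; rewrite -(splitK i); case: (fintype.split i) => j /=.
    by rewrite block_mxEul mxE eqxx.
  by rewrite block_mxEdr.
- move=> z j Dz; rewrite mul_mx_row -(splitK j).
  case: (fintype.split j) => i /=.
    by rewrite row_mxEl (ord1 i); exact: wD.
  by rewrite row_mxEr WD.
- move=> i b b1; rewrite -(splitK i); case: (fintype.split i) => j /=.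
    by rewrite rowKu (ord1 j) row_id; exact: cvD.
  by rewrite rowKd; exact: QD.
Qed.

Lemma adapted_coordinates {R : realType} {n : nat} (D : set 'rV[Cplx R]_n) :
  open D -> is_convex D -> nondegenerate_domain D -> D 0 ->
  exists2 W : 'M[Cplx R]_n, W \in unitmx &
    (forall z j, D z -> re ((z *m W) ord0 j) < 1) /\
    (forall z, \sum_(j < n) 2 ^+ j * `|(z *m W) ord0 j| < 1 -> D z).
Proof.
move=> Do Dc Dn D0.
have [Q [W [QWt QW1 WD QD]]] := adapted_system Do Dc Dn D0 (leqnn n).
have : Q *m W \in unitmx.
  rewrite unitmxE det_trig// big1 ?unitr1// => i _; exact: QW1.
rewrite unitmx_mul => /andP[Qu Wu].
exists W => //; split=> // z zW.
pose u := z *m invmx Q.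
have zE : z = u *m Q by rewrite mulmxKV.
apply/(gauge_lt1 Do Dc D0); rewrite zE mulmx_sum_row.
apply: le_lt_trans (gauge_sum Do Dc D0 _) _.
apply: (@le_lt_trans _ _ (\sum_i re `|u ord0 i|)).
  by apply: ler_sum => i _; apply: gauge_disc => // b; exact: QD.
rewrite -re_sum -ltr_cplx rmorph1 -[X in to_cplx (re X)]ger0_norm; last first.
  by apply: sumr_ge0.
rewrite -norm_re ger0_norm ?sumr_ge0//.
apply: le_lt_trans zW; apply: triangular_sum_le => j.
(* Column [j] of z W = u (Q W), solved for u_j: the diagonal entry is 1 and the terms with index
   below [j] vanish by triangularity. *)
have -> : u ord0 j = (z *m W) ord0 j -
    \sum_(k < n | (j < k)%N) u ord0 k * (Q *m W) k j.
  rewrite zE -mulmxA [(u *m _) _ _]mxE (bigD1 j)//= QW1 mulr1.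
  rewrite (bigID (fun k : 'I_n => (j < k)%N))/=.
  rewrite [X in _ + (_ + X)]big1 ?addr0; last first.
    move=> i /andP[ij]; rewrite -leqNgt leq_eqVlt
      (negbTE (_ : _ != _))//= => ji.
    by move/is_trig_mxP : QWt => ->//; rewrite mulr0.
  rewrite (eq_bigl (fun k : 'I_n => (j < k)%N)) ?addrK// => i.
  by rewrite andb_idl// => ji; rewrite gt_eqF.
apply: le_trans (ler_normB _ _) _; rewrite lerD2l.
apply: le_trans (ler_norm_sum _ _ _) _; apply: ler_sum => k _.
(* The entries of Q W have modulus at most 1: the disc along row [k] lies in [D], where each
   functional has real part below 1. *)
rewrite normrM ler_piMr//; apply: re_disc_le1 => b b1.
have -> : b * (Q *m W) k j = ((b *: row k Q) *m W) ord0 j.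
  by rewrite -scalemxAl -row_mul !mxE.
exact/WD/QD.
Qed.

(** * Moduli as real numbers, and the Cayley transform *)

Lemma re_norm_ge0 {R : realType} (z : Cplx R) : 0 <= re `|z|.
Proof. by rewrite -ler_cplx -norm_re rmorph0. Qed.

Lemma re_normM {R : realType} (z w : Cplx R) : re `|z * w| = re `|z| * re `|w|.
Proof.
by rewrite normrM (norm_re z) (norm_re w) -rmorphM re_to_cplx.
Qed.

Lemma re_norm_to_cplx {R : realType} (r : R) : re `|to_cplx r| = `|r|.
Proof. by rewrite norm_to_cplx. Qed.

Lemma unit_polydiscP {R : realType} {n : nat} (z : 'rV[Cplx R]_n) :
  unit_polydisc z <-> forall j, re `|z ord0 j| < 1.
Proof.
split=> zj j; have := zj j;
  by rewrite [`|_|]norm_re -(rmorph1 (@to_cplx R)) ltr_cplx.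
Qed.

Lemma unit_ballP {R : realType} {n : nat} (z : 'rV[Cplx R]_n) :
  unit_ball z <-> \sum_(j < n) re `|z ord0 j| ^+ 2 < 1.
Proof.
rewrite -(ltr_cplx _ 1) rmorph_sum rmorph1 /unit_ball/=.
by under [X in _ <-> is_true (X < _)]eq_bigr do rewrite rmorphXn/= -norm_re.
Qed.

Section cayley.
Context {R : realType}.
Implicit Types (l w : Cplx R).

(** The Möbius map from the half-plane Re l < 1 to the unit disc that fixes 0; its inverse is w ->
    2w / (1 + w). *)
Definition cayley l : Cplx R := l / (2 - l).

Lemma cayley_denom_neq0 l : re l < 1 -> 2 - l != 0.
Proof.
apply: contraTneq => /eqP; rewrite subr_eq0 => /eqP <-.
by rewrite -leNgt -[2](rmorph_nat (@to_cplx R)) re_to_cplx; lra.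
Qed.

(** Follows from |2 - l|^2 - |l|^2 = 4 (1 - Re l). *)
Lemma norm_cayley_lt1 l : re l < 1 -> `|cayley l| < 1.
Proof.
move=> l1; have d0 := cayley_denom_neq0 l1.
rewrite normf_div ltr_pdivrMr ?normr_gt0// mul1r.
rewrite !norm_cplx ltr_cplx ltr_sqrt.
  move: l1; rewrite -[2](rmorph_nat (@to_cplx R)); case: l {d0} => x y.
  by rewrite /re /im /=; nra.
have : 0 < `|2 - l| by rewrite normr_gt0.
by rewrite norm_cplx -(rmorph0 (@to_cplx R)) ltr_cplx sqrtr_gt0.
Qed.

Lemma cayley_inj l l' : 2 - l != 0 -> 2 - l' != 0 ->
  cayley l = cayley l' -> l = l'.
Proof.
move=> d d' /eqP; rewrite /cayley eqr_div// => /eqP e.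
have : 2 * l = 2 * l'.
  move: e; rewrite !mulrBr (mulrC l' l) => /addIr.
  by rewrite !(mulrC _ 2).
by apply: mulfI; rewrite pnatr_eq0.
Qed.

Lemma cayleyK w : 1 + w != 0 -> cayley (2 * w / (1 + w)) = w.
Proof.
move=> w1; have e : 2 - 2 * w / (1 + w) = 2 / (1 + w) by field.
rewrite /cayley e; field.
by rewrite w1.
Qed.

(** The reverse triangle inequality gives |1 + w| >= 1 - r > 0, so the inverse transform expands
    moduli by at most 2 / (1 - r). *)
Lemma norm_cayley_inv w (r : R) : re `|w| <= r -> r < 1 ->
  1 + w != 0 /\ re `|2 * w / (1 + w)| <= 2 / (1 - r) * re `|w|.
Proof.
move=> wr r1.
have h : 1 - r <= re `|1 + w|.
  have : `|1 : Cplx R| <= `|1 + w| + `|w|.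
    by rewrite -{1}[1](addrK w); exact: ler_normB.
  rewrite normr1 (norm_re w) (norm_re (1 + w)) -rmorphD -(rmorph1 (@to_cplx R)).
  by rewrite ler_cplx; lra.
have w1 : 1 + w != 0.
  apply/eqP => w0; move: h; rewrite w0 normr0 /re/=; lra.
split=> //; have h0 : 0 < re `|1 + w| by lra.
have -> : 2 * w / (1 + w) = to_cplx 2 * (w / (1 + w)).
  by rewrite rmorph_nat mulrA.
rewrite re_normM re_norm_to_cplx ger0_norm// -mulrA ler_pM2l//.
have := re_normM (w / (1 + w)) (1 + w); rewrite divfK// => ->.
rewrite mulrA mulrAC -[leLHS]mul1r ler_wpM2r ?re_norm_ge0//.
by rewrite mulrC ler_pdivlMr ?mul1r//; lra.
Qed.
End cayley.

(** * The model map into the polydisc, and lower bounds for suprema of radii *)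

Lemma squeezing_model {R : realType} {n : nat} (D : set 'rV[Cplx R]_n) z0 :
  open D -> is_convex D -> nondegenerate_domain D -> D z0 ->
  exists G : 'rV[Cplx R]_n -> 'rV[Cplx R]_n,
    squeezing_map unit_polydisc D z0 G /\
    forall (w : 'rV[Cplx R]_n) (r : R), r < 1 ->
      (forall j, re `|w ord0 j| <= r) ->
      \sum_(j < n) 2 ^+ j * re `|w ord0 j| < (1 - r) / 2 -> (G @` D) w.
Proof.
move=> Do Dc Dn Dz0; pose E : set 'rV[Cplx R]_n := [set x | D (x + z0)].
have Eo : open E.
  rewrite openE => x Ex.
  have cf : {for x, continuous (fun y : 'rV[Cplx R]_n => y + z0)}.
    apply: (@cvgD _ _ _ (nbhs x) (nbhs_filter _) id (cst z0) x z0) => //.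
    exact: (@cvg_cst _ z0 _ _ (nbhs_filter _)).
  by apply: cf; apply: open_nbhs_nbhs; split.
have Ec : is_convex E.
  move=> x y t; rewrite !inE => Ex Ey.
  have := Dc (x + z0) (y + z0) t; rewrite !inE => /(_ Ex Ey).
  rewrite /conv/= !scalerDr addrACA -[X in D (_ + X)]scalerDl.
  rewrite (_ : _ + _ = 1 :> Cplx R) ?scale1r//.
  exact: subrKC.
have En : nondegenerate_domain E.
  move=> a v v0 lE; apply: (Dn (a + z0) v v0) => _ [t _ <-].
  by rewrite addrAC; apply: lE; exists t.
have E0 : E 0 by rewrite /E/= add0r.
have [W Wu [WE EW]] := adapted_coordinates Eo Ec En E0.
pose l (z : 'rV[Cplx R]_n) j : Cplx R := ((z - z0) *m W) ord0 j.
have l1 z j : D z -> re (l z j) < 1 by move=> Dz; apply: WE; rewrite /E/= subrK.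
pose G (z : 'rV[Cplx R]_n) := \row_j cayley (l z j).
exists G; split; first split.
- move=> z Dz.
  have ld j : differentiable (l^~ j) z.
    rewrite (_ : l^~ j = \sum_(i < n)
        (fun y : 'rV[Cplx R]_n => (y ord0 i - z0 ord0 i) * W i j)).
      apply: differentiable_sum => i.
      have d1 : differentiable
          (fun y : 'rV[Cplx R]_n => y ord0 i - z0 ord0 i) z.
        have dc := differentiable_coord z ord0 i.
        exact: differentiableB dc (differentiable_cst _ _).
      have d2 : differentiable (cst (W i j) : 'rV[Cplx R]_n -> Cplx R) z.
        exact: differentiable_cst.
      exact: differentiableM d1 d2.
    apply/funext => y; rewrite /l mxE fct_sumE.
    by apply: eq_bigr => i _; rewrite !mxE.
  (* Written as a finite sum along the standard basis, [G] is differentiable as soon as each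
     coordinate is. *)
  rewrite (_ : G = \sum_(j < n) (fun y => cayley (l y j) *: delta_mx ord0 j)).
    apply: differentiable_sum => j; apply: differentiableZl.
    have d1 : differentiable (fun y => 2 - l y j) z.
      exact: differentiableB (differentiable_cst _ _) (ld j).
    have d2 := differentiableV d1 (cayley_denom_neq0 (l1 _ _ Dz)).
    exact: differentiableM (ld j) d2.
  apply/funext => y; rewrite fct_sumE [LHS]row_sum_delta.
  by apply: eq_bigr => j _; rewrite mxE.
- move=> z z' /set_mem Dz /set_mem Dz' /rowP GG.
  have : (z - z0) *m W = (z' - z0) *m W.
    apply/rowP => j; have := GG j; rewrite [LHS]mxE [RHS]mxE.
    by apply: cayley_inj; exact/cayley_denom_neq0/l1.
  by move=> /(congr1 (mulmx^~ (invmx W))); rewrite !mulmxK// => /addIr.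
- move=> _ [z Dz <-] j; rewrite mxE; exact/norm_cayley_lt1/l1.
- apply/rowP => j; rewrite !mxE /l subrr mul0mx mxE /cayley mul0r//.
- move=> w r r1 wr wsum.
  (* The values of the functionals at the sought preimage, by inverting the Cayley transform in each
     coordinate. Their moduli grow by at most 2 / (1 - r), so the bound (1 - r) / 2 brings their
     weighted sum below 1. *)
  pose x : 'rV[Cplx R]_n := \row_j (2 * w ord0 j / (1 + w ord0 j)).
  exists (x *m invmx W + z0).
    apply: EW; rewrite mulmxKV//.
    under eq_bigr => j _.
      have -> : 2 ^+ j * `|x ord0 j| = to_cplx (2 ^+ j * re `|x ord0 j|).
        by rewrite norm_re rmorphM rmorphXn/= rmorph_nat.
      over.
    rewrite -rmorph_sum -(rmorph1 (@to_cplx R)) ltr_cplx.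
    have r2 : 0 < 2 / (1 - r) by rewrite divr_gt0// subr_gt0.
    apply: (@le_lt_trans _ _
        (2 / (1 - r) * \sum_(j < n) 2 ^+ j * re `|w ord0 j|)).
      rewrite mulr_sumr; apply: ler_sum => j _.
      rewrite mulrCA ler_wpM2l ?exprn_ge0//.
      by rewrite mxE; have [] := norm_cayley_inv (wr j) r1.
    by rewrite -ltr_pdivlMl// invf_div mulr1.
  apply/rowP => j; rewrite mxE /l addrK mulmxKV// mxE cayleyK//.
  by have [] := norm_cayley_inv (wr j) r1.
Qed.

(** Both suprema must be shown to be over bounded sets. A radius s > 1 is impossible: s^-1 e_j0 lies
    in [Omega], so e_j0 would lie in the image of the map, hence in the open polydisc. *)
Lemma squeezing_ge {R : realType} {n : nat} (Omega D : set 'rV[Cplx R]_n) z F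
    (r : R) (j0 : 'I_n) :
  Omega `<=` unit_polydisc ->
  (forall c : Cplx R, `|c| < 1 -> Omega (c *: delta_mx ord0 j0)) ->
  squeezing_map Omega D z F -> 0 < r -> dilate r Omega `<=` F @` D ->
  r <= squeezing Omega D z.
Proof.
move=> Op Od Fs r0 rF.
have le1 H s : squeezing_map Omega D z H -> 0 < s ->
    dilate s Omega `<=` H @` D -> s <= 1.
  move=> [_ _ HO _] s0 sH; rewrite leNgt; apply/negP => s1.
  have : unit_polydisc (to_cplx s *: (to_cplx s^-1 *: delta_mx ord0 j0)).
    apply/Op/HO/sH; eexists; last reflexivity; apply: Od.
    rewrite norm_to_cplx -(rmorph1 (@to_cplx R)) ltr_cplx gtr0_norm ?invr_gt0//.
    by rewrite invf_lt1.
  move=> /(_ j0); rewrite scalerA -rmorphM divff ?gt_eqF// rmorph1 scale1r.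
  by rewrite mxE !eqxx normr1 ltxx.
have rad_ub H : squeezing_map Omega D z H ->
    has_ubound [set s : R | 0 < s /\ dilate s Omega `<=` H @` D].
  by move=> Hs; exists 1 => s [s0]; exact: le1.
apply: le_trans (_ : squeezing_radius Omega D F <= _).
  by apply: ub_le_sup; [exact: rad_ub|split].
apply: ub_le_sup; last by exists F.
exists 1 => _ [H Hs <-]; rewrite /squeezing_radius.
(* A map without any admissible radius has radius [sup set0 = 0], still at most 1. *)
set S := [set s | _]; have [->|/set0P ne] := eqVneq S set0.
  by rewrite sup0.
by apply: ge_sup => // s [s0]; exact: le1.
Qed.

(** * The constant c_n and the two lower bounds *)

Lemma c_const_sqr (R : realType) (n : nat) :
  c_const R n ^+ 2 = \sum_(j < n) (2 ^+ j) ^+ 2.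
Proof.
rewrite expr_div_n !sqr_sqrtr ?subr_ge0 ?exprn_ege1 ?ler1n// subrX1.
have -> : 4 - 1 = 3 :> R by lra.
rewrite mulrAC divff ?pnatr_eq0// mul1r.
by apply: eq_bigr => j _; rewrite exprAC -natrX.
Qed.

Lemma c_const_gt0 (R : realType) (n : nat) : (0 < n)%N -> 0 < c_const R n.
Proof.
move=> n0; rewrite divr_gt0 ?sqrtr_gt0 ?subr_gt0//.
by rewrite exprn_egt1 ?ltr1n// -lt0n.
Qed.

Lemma unit_ball_polydisc {R : realType} {n : nat} :
  @unit_ball R n `<=` unit_polydisc.
Proof.
move=> z /unit_ballP zB; apply/unit_polydiscP => j.
rewrite -(@expr_lt1 _ 2)// ?re_norm_ge0//; apply: le_lt_trans zB.
by rewrite (bigD1 j)//= lerDl sumr_ge0// => i _; exact: sqr_ge0.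
Qed.

Lemma dot_pow2_lt_c_const {R : realType} {n : nat} (y : 'I_n -> R) :
  (0 < n)%N -> \sum_j y j ^+ 2 < 1 -> \sum_(j < n) 2 ^+ j * y j < c_const R n.
Proof.
move=> n0 y1; set c := c_const R n.
have c0 : 0 < c by exact: c_const_gt0.
(* AM-GM: [2^j y <= (4^j / c + c y^2) / 2] *)
apply: (@le_lt_trans _ _ ((c^-1 * \sum_(j < n) (2 ^+ j) ^+ 2 +
                           c * \sum_j y j ^+ 2) / 2)).
  rewrite !mulr_sumr -big_split/= mulr_suml; apply: ler_sum => j _.
  have : 0 <= c^-1 * (2 ^+ j - c * y j) ^+ 2.
    by rewrite mulr_ge0 ?sqr_ge0// invr_ge0 ltW.
  have -> : c^-1 * (2 ^+ j - c * y j) ^+ 2 =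
      c^-1 * (2 ^+ j) ^+ 2 - 2 * (2 ^+ j * y j) + c * y j ^+ 2.
    by field; rewrite gt_eqF.
  lra.
(* The bound is now (c + c * sum of y_j^2) / 2, which is strictly below c. *)
rewrite -c_const_sqr -/c expr2 mulKf ?gt_eqF//; nra.
Qed.

Lemma squeezing_map_scale {R : realType} {n : nat}
    (Omega Omega' D : set 'rV[Cplx R]_n) z F (s : R) :
  0 < s -> (forall w, Omega w -> Omega' (to_cplx s *: w)) ->
  squeezing_map Omega D z F ->
  squeezing_map Omega' D z (fun x => to_cplx s *: F x).
Proof.
move=> s0 sO [Fh Fi FO Fz]; split.
- by move=> x Dx; exact: differentiableZ (Fh x Dx).
- move=> x y Dx Dy /scalerI xy; apply: Fi => //; apply: xy.
  by rewrite -(rmorph0 (@to_cplx R)) (inj_eq (fmorph_inj _)) gt_eqF.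
- by move=> _ [x Dx <-]; apply: sO; apply: FO; exists x.
- by rewrite Fz scaler0.
Qed.

Theorem theorem1p1 (R : realType) (n : nat) (n_ge2 : (2 <= n)%N)
    (D : set 'rV[Cplx R]_n) (D_domain : is_domain D) (D_convex : is_convex D)
    (D_nondeg : nondegenerate_domain D) :
  forall z, D z ->
    1 / (Num.sqrt n%:R * (2 * c_const R n + 1)) <= s_ball D z /\
    1 / (2 ^+ n.+1 - 1) <= s_polydisc D z.
Proof.
move=> z Dz; have [Do _ _] := D_domain.
have [G [Gs GD]] := squeezing_model Do D_convex D_nondeg Dz.
have n0 : (0 < n)%N by exact: ltnW.
pose j0 := Ordinal n0; have dE c j :
    re `|(c *: delta_mx ord0 j0 : 'rV[Cplx R]_n) ord0 j| =
    if j == j0 then re `|c| else 0.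
  rewrite !mxE eqxx andTb; case: eqP => _; first by rewrite mulr1.
  by rewrite mulr0 normr0.
have re1 (c : Cplx R) : `|c| < 1 -> re `|c| < 1.
  by rewrite norm_re -(rmorph1 (@to_cplx R)) ltr_cplx.
split; last first.
  have N1 : 1 < (2 : R) ^+ n by rewrite exprn_egt1 ?ltr1n// -lt0n.
  (* This [r] solves (2^n - 1) r = (1 - r) / 2, and 2^n - 1 is the sum of the weights 2^j.
     Strictness comes from the open polydisc. *)
  rewrite div1r exprS; set N := 2 ^+ n in N1 *; set r := (2 * N - 1)^-1.
  have r0 : 0 < r by rewrite invr_gt0; lra.
  have rN : r * (2 * N - 1) = 1 by rewrite mulVf// gt_eqF//; lra.
  apply: (squeezing_ge (F := G) (j0 := j0)) => //.
    move=> c /re1 c1; apply/unit_polydiscP => j.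
    by rewrite dE; case: ifP.
  move=> _ [y /unit_polydiscP y1 <-].
  have yr j : re `|(to_cplx r *: y) ord0 j| = r * re `|y ord0 j|.
    by rewrite mxE re_normM re_norm_to_cplx gtr0_norm.
  apply: (GD _ r); first by nra.
    by move=> j; rewrite yr ler_piMr ?ltW.
  apply: (@lt_le_trans _ _ (\sum_(j < n) 2 ^+ j * r)).
    apply: ltr_sum => [|j _].
      by apply/hasP; exists j0; rewrite ?mem_index_enum.
    by rewrite yr ltr_pM2l ?exprn_gt0// gtr_pMr.
  have := subrX1 (2 : R) n; rewrite -mulr_suml -/N; nra.
have c0 := c_const_gt0 R n0; set c := c_const R n in c0 *.
have n0' : 0 < Num.sqrt n%:R :> R by rewrite sqrtr_gt0 ltr0n.
(* The factor [s] brings the polydisc into the ball, and [r] solves r c = (1 - r) / 2, the condition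
   on [G] once the weighted sum is bounded by c. *)
set s := (Num.sqrt n%:R)^-1 : R; set r := (2 * c + 1)^-1.
have s0 : 0 < s by rewrite invr_gt0.
have r0 : 0 < r by rewrite invr_gt0; lra.
have rc : r * (2 * c + 1) = 1 by rewrite mulVf// gt_eqF//; lra.
rewrite div1r invfM -/s -/r.
have Gs' := squeezing_map_scale (Omega' := unit_ball) s0 _ Gs.
apply: (squeezing_ge (F := fun x => to_cplx s *: G x) (j0 := j0)).
- exact: unit_ball_polydisc.
- move=> a /re1 a1; apply/unit_ballP; rewrite (bigD1 j0)//= dE eqxx.
  rewrite big1 ?addr0 ?expr_lt1 ?re_norm_ge0// => j /negbTE jj0.
  by rewrite dE jj0 expr0n.
- apply: Gs' => w /unit_polydiscP w1; apply/unit_ballP.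
  apply: (@lt_le_trans _ _ (\sum_(j < n) s ^+ 2)).
    apply: ltr_sum => [|j _].
      by apply/hasP; exists j0; rewrite ?mem_index_enum.
    rewrite mxE re_normM re_norm_to_cplx gtr0_norm// exprMn.
    by rewrite gtr_pMr ?exprn_gt0// expr_lt1 ?re_norm_ge0.
  rewrite sumr_const card_ord exprVn sqr_sqrtr ?ler0n// -(mulr_natl n%:R^-1).
  by rewrite divff ?pnatr_eq0 -?lt0n.
- exact: mulr_gt0.
(* It suffices that [G] attains r y: composing with the scaling by s then attains s r y. *)
move=> _ [y yB <-]; have /unit_polydiscP y1 := unit_ball_polydisc yB.
have yr j : re `|(to_cplx r *: y) ord0 j| = r * re `|y ord0 j|.
  by rewrite mxE re_normM re_norm_to_cplx gtr0_norm.
have [|||x Dx xG] := GD (to_cplx r *: y) r.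
- by nra.
- by move=> j; rewrite yr ler_piMr ?ltW.
- under eq_bigr do rewrite yr mulrCA; rewrite -mulr_sumr.
  have := dot_pow2_lt_c_const n0 (iffLR (unit_ballP _) yB); rewrite -/c; nra.
by exists x => //; rewrite xG scalerA -rmorphM.
Qed.
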